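(* Let $n \geq 1$ and $0 \leq k \leq n$ be integers, let $N = 2^n$, and let $A = S(n,k) \subseteq \mathbb{F}_2^n$ be the Hamming sphere of vectors with exactly $k$ coordinates equal to $1$. Then \[ \mu(A) = \frac{1}{N}\,\frac{E(A)}{|A|^2}. \] Equivalently, among nonzero functions $f:\mathbb{F}_2^n\to\mathbb{R}$ supported on $A$, the ratio $\|f\|_{u_2}^4/\|f\|_2^4$ is maximised when $f$ is constant on $A$ (i.e. $f$ is a nonzero multiple of the indicator function $\mathds{1}_A$).
   Context: For $f:\mathbb{F}_2^n\to\mathbb{R}$, the Gowers $u_2$ norm (additive energy) is \[ \|f\|_{u_2} = \Big(\mathbb{E}_{a_1,a_2,a_3,a_4\in\mathbb{F}_2^n,\ a_1+a_2=a_3+a_4} f(a_1)f(a_2)f(a_3)f(a_4)\Big)^{1/4}, \] where the expectation is uniform over all quadruples in $(\mathbb{F}_2^n)^4$ satisfying $a_1+a_2=a_3+a_4$, and $\|f\|_2 = \big(\mathbb{E}_{a\in\mathbb{F}_2^n} f(a)^2\big)^{1/2}$. For $A\subseteq\mathbb{F}_2^n$, \[ \mu(A) = \max_{f:\mathbb{F}_2^n\to\mathbb{R},\ f\neq 0,\ \mathrm{supp}(f)\subseteq A} \frac{\|f\|_{u_2}^4}{\|f\|_2^4}, \] where $\mathrm{supp}(f)$ is the support of $f$. The additive energy of a set $A$ is $E(A) = \#\{(a_1,a_2,a_3,a_4)\in A^4 : a_1+a_2=a_3+a_4\}$, so that $\|\mathds{1}_A\|_{u_2}^4 = E(A)/N^3$.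 *)

(* Defs.v *)
From mathcomp Require Import all_boot all_order all_algebra.
From mathcomp Require Import classical_sets reals exp.
Set Implicit Arguments.
Unset Strict Implicit.
Unset Printing Implicit Defensive.
Import Order.TTheory GRing.Theory Num.Theory.

Local Open Scope ring_scope.

Notation "''F2^' n" := 'rV['F_2]_n (at level 8, n at level 2, format "''F2^' n").

Definition expect (R : realType) (T : finType) (S : {set T}) (F : T -> R) : R :=
  (\sum_(x in S) F x) / #|S|%:R.

(* A quadruple (a1, a2, a3, a4) is the left-nested pair (((a1, a2), a3), a4). *)
Definition additive_quads (n : nat) : {set 'F2^n * 'F2^n * 'F2^n * 'F2^n} :=
  [set q | let: (a1, a2, a3, a4) := q in a1 + a2 == a3 + a4].

(* The expectation below is always nonnegative, so the real power [powR] is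
   its genuine fourth root. *)
Definition u2norm (R : realType) (n : nat) (f : {ffun 'F2^n -> R}) : R :=
  (expect (additive_quads n)
     (fun q => let: (a1, a2, a3, a4) := q in f a1 * f a2 * f a3 * f a4))
    `^ (4%:R^-1).

Definition l2norm (R : realType) (n : nat) (f : {ffun 'F2^n -> R}) : R :=
  Num.sqrt (expect [set: 'F2^n] (fun a => f a ^+ 2)).

Definition u2_ratio (R : realType) (n : nat) (f : {ffun 'F2^n -> R}) : R :=
  u2norm f ^+ 4 / l2norm f ^+ 4.

Definition admissible (R : realType) (n : nat) (A : {set 'F2^n})
    (f : {ffun 'F2^n -> R}) : Prop :=
  f != 0 /\ support f \subset A.

Definition is_maximizer (R : realType) (n : nat) (A : {set 'F2^n})
    (g : {ffun 'F2^n -> R}) : Prop :=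
  admissible A g /\
  forall f : {ffun 'F2^n -> R}, admissible A f -> u2_ratio f <= u2_ratio g.

(* The supremum is the maximum as soon as some [g] satisfies [is_maximizer A g];
   for empty [A] there is no admissible function and the value is junk. *)
Definition mu (R : realType) (n : nat) (A : {set 'F2^n}) : R :=
  sup [set u2_ratio f | f in [set f : {ffun 'F2^n -> R} | admissible A f]]%classic.

Definition additive_energy (n : nat) (A : {set 'F2^n}) : nat :=
  #|[set q in additive_quads n |
      let: (a1, a2, a3, a4) := q in
      [&& a1 \in A, a2 \in A, a3 \in A & a4 \in A]]|.

Definition indicator (R : realType) (n : nat) (A : {set 'F2^n}) :
    {ffun 'F2^n -> R} :=
  [ffun x => (x \in A)%:R].

Definition hamming_sphere (n k : nat) : {set 'F2^n} :=
  [set v : 'F2^n | #|[set i : 'I_n | v ord0 i == 1]| == k].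

(* Main.v *)
(** Write r(s) = sum_a f(a) f(a + s) for the autocorrelation of f, so that the
    unnormalised energy of f is sum_s r(s)^2.  Exchanging two coordinates is a
    transvection t(x) = x + l(x) e with l linear and l(e) = 0.  Replacing f >= 0 by
    f~ = sqrt ((f^2 + (f o t)^2) / 2) keeps the l2 norm.  Split f = f0 + f1 according
    to the value of l, and let r0, r1 be the autocorrelations of f0, f1; since
    sum_s (f0 * f1)(s)^2 = sum_s r0(s) r1(s), the energy of f is
    sum_s (r0^2 + 6 r0 r1 + r1^2).  Symmetrising does not change r0, and by
    Cauchy-Schwarz on the pairs {x, x + e} it increases r1 pointwise, strictly at
    s = e unless f o t = f.  Hence a nonnegative maximiser of the energy on the unit
    sphere of functions supported on S(n,k), which exists by compactness, is
    invariant under all coordinate permutations, i.e. constant on S(n,k). *)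

Require Import Defs.
From mathcomp Require Import boolp classical_sets functions reals topology.
From mathcomp Require Import normedtype derive realfun exp.
From mathcomp Require Import all_boot all_order all_fingroup all_algebra.
From mathcomp Require Import ring.
Import Order.TTheory GRing.Theory Num.Theory.
Import numFieldNormedType.Exports.
Local Open Scope ring_scope.

(** * Elementary facts about finite sums and squares *)

Lemma CauchySchwarz2 (R : rcfType) (x y z w : R) :
  x * y + z * w <= Num.sqrt (x ^+ 2 + z ^+ 2) * Num.sqrt (y ^+ 2 + w ^+ 2).
Proof.
rewrite -sqrtrM ?addr_ge0 ?sqr_ge0 //.
apply: (le_trans (ler_norm _)); rewrite -sqrtr_sqr ler_wsqrtr // -subr_ge0.
rewrite [X in 0 <= X](_ : _ = (x * w - z * y) ^+ 2) ?sqr_ge0 //; ring.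
Qed.

Lemma ltr_sum_at (R : numDomainType) (I : finType) (j : I) (F G : I -> R) :
  (forall i, F i <= G i) -> F j < G j -> \sum_i F i < \sum_i G i.
Proof.
move=> FG FGj; rewrite (bigD1 j) //= [ltRHS](bigD1 j) //= ltr_leD //.
exact: ler_sum.
Qed.

Lemma sum_sqr_eq0 (R : realDomainType) (T : finType) (f : T -> R) :
  \sum_x f x ^+ 2 = 0 -> f =1 fun=> 0.
Proof.
move=> f0 x; apply/eqP; rewrite -sqrf_eq0; apply/eqP.
by apply: (psumr_eq0P _ f0) => // y _; apply: sqr_ge0.
Qed.

(** * Correlations and energy on a finite group of exponent two *)

Section Correlation.
Variables (R : realType) (V : finZmodType).
Hypothesis addVV : forall x : V, x + x = 0.
Implicit Types f g : V -> R.

(** Since [x + x = 0] in [V], this is also the convolution of [f] and [g]. *)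
Definition correlation f g (s : V) : R := \sum_a f a * g (a + s).

Definition energy f : R := \sum_s correlation f f s ^+ 2.

Let addVK (x y : V) : x + y + y = x.
Proof. by rewrite -addrA addVV addr0. Qed.

Lemma eq_correlation f f' g g' :
  f =1 f' -> g =1 g' -> correlation f g =1 correlation f' g'.
Proof. by move=> ff gg s; apply: eq_bigr => a _; rewrite ff gg. Qed.

Lemma eq_energy f g : f =1 g -> energy f = energy g.
Proof. by move=> fg; apply: eq_bigr => s _; rewrite (eq_correlation _ _ _ _ fg fg). Qed.

Lemma correlationC f g s : correlation f g s = correlation g f s.
Proof.
rewrite /correlation (reindex_inj (addIr s)) /=.
by apply: eq_bigr => a _; rewrite addVK mulrC.
Qed.

Lemma correlationDl f1 f2 g s :
  correlation (f1 \+ f2) g s = correlation f1 g s + correlation f2 g s.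
Proof. by rewrite -big_split; apply: eq_bigr => a _; rewrite /= mulrDl. Qed.

Lemma correlationDr f g1 g2 s :
  correlation f (g1 \+ g2) s = correlation f g1 s + correlation f g2 s.
Proof. by rewrite !(correlationC f) correlationDl. Qed.

Lemma correlation_ge0 f g s :
  (forall x, 0 <= f x) -> (forall x, 0 <= g x) -> 0 <= correlation f g s.
Proof. by move=> f0 g0; apply: sumr_ge0 => a _; apply: mulr_ge0. Qed.

Lemma energy_ge0 f : 0 <= energy f.
Proof. by apply: sumr_ge0 => s _; apply: sqr_ge0. Qed.

Lemma energyZ c f : energy (fun x => c * f x) = c ^+ 4 * energy f.
Proof.
rewrite mulr_sumr; apply: eq_bigr => s _.
have -> : correlation (fun x => c * f x) (fun x => c * f x) s = c ^+ 2 * correlation f f s.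
  by rewrite mulr_sumr; apply: eq_bigr => a _; ring.
by ring.
Qed.

(** Triangle inequality in each correlation. It lets a maximiser be replaced by its absolute value,
    as symmetrisation requires nonnegativity. *)
Lemma energy_le_abs f : energy f <= energy (fun x => `|f x|).
Proof.
apply: ler_sum => s _; rewrite -ler_sqrt ?sqr_ge0 // !sqrtr_sqr.
rewrite [leRHS]ger0_norm ?correlation_ge0 //.
by apply: le_trans (ler_norm_sum _ _ _) _; apply: ler_sum => a _; rewrite normrM.
Qed.

(** In exponent two the constraint determines [a4 = a3 + (a1 + a2)], so the sum over [a3] is the
    correlation at [a1 + a2]. Grouping the pairs [(a1, a2)] by their sum [s] produces a second
    factor, the correlation at [s]. *)
Lemma energyE f :
  \sum_(q : V * V * V * V | let: (a1, a2, a3, a4) := q in a1 + a2 == a3 + a4)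
     (let: (a1, a2, a3, a4) := q in f a1 * f a2 * f a3 * f a4) = energy f.
Proof.
transitivity (\sum_(p : V * V) f p.1 * f p.2 * correlation f f (p.1 + p.2)).
  transitivity (\sum_(t : V * V * V) f t.1.1 * f t.1.2 *
                  (f t.2 * f (t.2 + (t.1.1 + t.1.2)))).
    pose G (t : V * V * V) d := if t.1.1 + t.1.2 == t.2 + d
      then f t.1.1 * f t.1.2 * f t.2 * f d else 0.
    transitivity (\sum_t \sum_d G t d).
      by rewrite pair_bigA big_mkcond; apply: eq_bigr => -[[[? ?] ?] ?].
    apply: eq_bigr => -[[a1 a2] a3] _ /=.
    rewrite /G -big_mkcond (big_pred1 (a3 + (a1 + a2))) ?mulrA // => a4 /=.
    apply/eqP/eqP => [->|->]; first by rewrite addrA addVV add0r.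
    by rewrite addrA addVV add0r.
  rewrite -(pair_bigA _ (fun (p : V * V) a => f p.1 * f p.2 * (f a * f (a + (p.1 + p.2))))).
  by apply: eq_bigr => p _; rewrite -mulr_sumr.
rewrite -(pair_bigA _ (fun a b => f a * f b * correlation f f (a + b))) /=.
under eq_bigr => a _ do rewrite (reindex_inj (addrI a)) /=.
rewrite exchange_big; apply: eq_bigr => s _; rewrite expr2 mulr_suml.
by apply: eq_bigr => a _; rewrite addrA addVV add0r.
Qed.

(** Both sides are the sum of [f a * f (a + b) * g c * g (c + b)] over all [a], [b], [c]: expand the
    square with second variable [a + b], then substitute [c = a + s]. *)
Lemma sum_correlation_sqr f g :
  \sum_s correlation f g s ^+ 2 = \sum_s correlation f f s * correlation g g s.
Proof.
transitivity (\sum_s \sum_a \sum_b f a * f (a + b) * (g (a + s) * g (a + s + b))).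
  apply: eq_bigr => s _; rewrite expr2 mulr_suml; apply: eq_bigr => a _.
  rewrite mulr_sumr (reindex_inj (addrI a)) /=; apply: eq_bigr => b _.
  rewrite [a + b + s]addrAC; ring.
transitivity (\sum_a \sum_b \sum_s f a * f (a + b) * (g s * g (s + b))).
  rewrite exchange_big; apply: eq_bigr => a _.
  rewrite exchange_big; apply: eq_bigr => b _.
  by rewrite [RHS](reindex_inj (addrI a)).
rewrite exchange_big; apply: eq_bigr => b _.
by rewrite mulr_suml; apply: eq_bigr => a _; rewrite mulr_sumr.
Qed.

(** * Symmetrisation along a transvection *)

Section Transvection.
Variables (l : V -> bool) (e : V).
Hypotheses (lD : forall x y, l (x + y) = l x (+) l y) (le : l e = false).

(** The functional [l] takes values in [bool], with exclusive or as addition, so adding [l(x) e]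
    becomes a conditional. *)
Definition transvection x := if l x then x + e else x.

Lemma transvectionK : involutive transvection.
Proof.
by move=> x; rewrite /transvection; case lx: (l x); rewrite ?lD lx ?le //= addVK.
Qed.

Definition symmetrize f x := Num.sqrt ((f x ^+ 2 + f (transvection x) ^+ 2) / 2).

Definition on_hyperplane f x := if l x then 0 else f x.
Definition off_hyperplane f x := if l x then f x else 0.

(* r00 and r11 vanish on [l s], r01 vanishes off it, so no cross term survives in
   the square of [r00 + 2 r01 + r11]. *)
Lemma energy_split f (f0 := on_hyperplane f) (f1 := off_hyperplane f) :
  energy f = \sum_s (correlation f0 f0 s ^+ 2
    + correlation f0 f0 s * correlation f1 f1 s *+ 6 + correlation f1 f1 s ^+ 2).
Proof.
have fE : f =1 f0 \+ f1.
  move=> x; rewrite /= /f0 /f1 /on_hyperplane /off_hyperplane.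
  by case: (l x); rewrite ?add0r ?addr0.
have r00 s : l s -> correlation f0 f0 s = 0.
  move=> ls; rewrite /correlation big1 // => a _.
  by rewrite /f0 /on_hyperplane lD ls; case: (l a); rewrite /= ?mul0r ?mulr0.
have r11 s : l s -> correlation f1 f1 s = 0.
  move=> ls; rewrite /correlation big1 // => a _.
  by rewrite /f1 /off_hyperplane lD ls; case: (l a); rewrite /= ?mul0r ?mulr0.
have r01 s : ~~ l s -> correlation f0 f1 s = 0.
  move=> /negbTE ls; rewrite /correlation big1 // => a _.
  rewrite /f0 /f1 /on_hyperplane /off_hyperplane lD ls.
  by case: (l a); rewrite /= ?mul0r ?mulr0.
rewrite /energy.
transitivity (\sum_s (correlation f0 f0 s ^+ 2 + correlation f0 f0 s * correlation f1 f1 s *+ 2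
     + correlation f1 f1 s ^+ 2 + correlation f0 f1 s ^+ 2 *+ 4)).
  apply: eq_bigr => s _.
  rewrite (eq_correlation _ _ _ _ fE fE) correlationDl !correlationDr (correlationC f1 f0).
  by have [ls|ls] := boolP (l s); [rewrite r00 // r11 //|rewrite r01 //]; ring.
rewrite big_split /= sumrMnl sum_correlation_sqr -sumrMnl -big_split /=.
by apply: eq_bigr => s _; ring.
Qed.

Variable f : V -> R.
Hypothesis f_ge0 : forall x, 0 <= f x.

Lemma sum_symmetrize_sqr : \sum_x symmetrize f x ^+ 2 = \sum_x f x ^+ 2.
Proof.
under eq_bigr do rewrite sqr_sqrtr ?divr_ge0 ?addr_ge0 ?sqr_ge0 //.
rewrite -mulr_suml big_split /=.
have -> : \sum_x f (transvection x) ^+ 2 = \sum_x f x ^+ 2.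
  by rewrite [RHS](reindex_inj (inv_inj transvectionK)).
by field.
Qed.

(** Where [l] vanishes the transvection fixes [x], and the root of [f x ^+ 2] is [f x] because [f]
    is nonnegative. *)
Lemma on_hyperplane_symmetrize : on_hyperplane (symmetrize f) =1 on_hyperplane f.
Proof.
move=> x; rewrite /on_hyperplane /symmetrize /transvection; case: (l x) => //=.
have -> : (f x ^+ 2 + f x ^+ 2) / 2 = f x ^+ 2 by field.
by rewrite sqrtr_sqr ger0_norm.
Qed.

(* Averages the sum with its translate by [e]. *)
Let off_pair s : correlation (off_hyperplane f) (off_hyperplane f) s =
  (\sum_a if l a && l (a + s) then f a * f (a + s) + f (a + e) * f (a + e + s) else 0) / 2.
Proof.
set S := correlation _ _ s; rewrite -[S](mulfK (_ : (2 : R) != 0)) ?pnatr_eq0 //.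
congr (_ / _); rewrite mulr_natr mulr2n.
rewrite {2}/S /correlation (reindex_inj (addIr e)) -big_split /=.
apply: eq_bigr => a _; rewrite /off_hyperplane !lD le !addbF.
by case: (l a) => /=; rewrite ?mul0r ?addr0 //; case: (l s); rewrite /= ?mulr0 ?addr0.
Qed.

Lemma symmetrizeE x : l x -> symmetrize f x = Num.sqrt ((f x ^+ 2 + f (x + e) ^+ 2) / 2).
Proof. by rewrite /symmetrize /transvection => ->. Qed.

(** Each term of the paired sum is an inner product of [(f a, f (a + e))] with
    [(f (a + s), f (a + s + e))]; the symmetrised term is the product of their norms, up to the same
    factor 1/2. *)
Lemma correlation_off_symmetrize s :
  correlation (off_hyperplane f) (off_hyperplane f) s <=
  correlation (off_hyperplane (symmetrize f)) (off_hyperplane (symmetrize f)) s.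
Proof.
rewrite off_pair mulr_suml; apply: ler_sum => a _.
rewrite /off_hyperplane; case: ifP; last first.
  by case: (l a); case: (l (a + s)); rewrite ?mul0r ?mulr0.
case/andP=> la las; rewrite la las !symmetrizeE // !sqrtrM ?addr_ge0 ?sqr_ge0 //.
rewrite mulrACA -expr2 sqr_sqrtr ?invr_ge0 // ler_pM2r ?invr_gt0 //.
by rewrite [a + s + e]addrAC CauchySchwarz2.
Qed.

(** At the shift [e] the paired term is [f a * f (a + e)] and the symmetrised one is the mean of the
    two squares. They differ by half of [(f a - f (a + e)) ^+ 2], which is positive at [a = x]. *)
Lemma correlation_off_symmetrize_lt x : l x -> f (x + e) != f x ->
  correlation (off_hyperplane f) (off_hyperplane f) e <
  correlation (off_hyperplane (symmetrize f)) (off_hyperplane (symmetrize f)) e.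
Proof.
move=> lx fx.
have symE a : l a -> symmetrize f a * symmetrize f (a + e) = (f a ^+ 2 + f (a + e) ^+ 2) / 2.
  move=> la; rewrite !symmetrizeE ?lD ?la ?le // addVK [f (a + e) ^+ 2 + _]addrC -expr2.
  by rewrite sqr_sqrtr ?divr_ge0 ?addr_ge0 ?sqr_ge0.
rewrite off_pair mulr_suml; apply: (@ltr_sum_at _ _ x) => [a|].
  rewrite lD le addbF andbb /off_hyperplane lD le addbF.
  case: ifP => la; last by rewrite !mul0r.
  rewrite symE // addVK ler_pM2r ?invr_gt0 // -subr_ge0.
  rewrite [X in 0 <= X](_ : _ = (f a - f (a + e)) ^+ 2) ?sqr_ge0 //; ring.
rewrite lD le addbF andbb /off_hyperplane lD le addbF lx.
rewrite symE // addVK ltr_pM2r ?invr_gt0 // -subr_gt0.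
rewrite [X in 0 < X](_ : _ = (f (x + e) - f x) ^+ 2); last by ring.
by rewrite exprn_even_gt0 //= subr_eq0.
Qed.

(** Termwise comparison in [energy_split]. Strictness comes from the square of the off-hyperplane
    correlation at [e], since the mixed term may vanish there. *)
Lemma energy_symmetrize_lt x : f (transvection x) != f x ->
  energy f < energy (symmetrize f).
Proof.
rewrite {1}/transvection; case: ifP => [lx fx|_]; last by rewrite eqxx.
have f0E s := eq_correlation _ _ _ _ on_hyperplane_symmetrize on_hyperplane_symmetrize s.
have on0 s : 0 <= correlation (on_hyperplane f) (on_hyperplane f) s.
  by apply: correlation_ge0 => a; rewrite /on_hyperplane; case: ifP.
have off0 s : 0 <= correlation (off_hyperplane f) (off_hyperplane f) s.
  by apply: correlation_ge0 => a; rewrite /off_hyperplane; case: ifP.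
rewrite !energy_split; apply: (@ltr_sum_at _ _ e) => [s|].
  rewrite f0E; apply: lerD; first by
    rewrite lerD2l lerMn2r ler_wpM2l ?correlation_off_symmetrize.
  by rewrite ler_pXn2r ?nnegrE // ?(le_trans (off0 s)) ?correlation_off_symmetrize.
have lt_e := correlation_off_symmetrize_lt x lx fx.
rewrite f0E; apply: ler_ltD; first by rewrite lerD2l lerMn2r ler_wpM2l ?(ltW lt_e).
by rewrite ltr_pXn2r ?nnegrE // ?(le_trans (off0 e)) ?(ltW lt_e).
Qed.


End Transvection.
End Correlation.

Arguments correlation {R V}.
Arguments energy {R V}.

(** * Existence of a maximiser by compactness *)

Lemma sphere_maximizer (R : realType) (T : finType) (A : {set T})
    (Q : (T -> R) -> R) (Qcont : continuous (Q : prod_topology (fun=> R) -> R))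
    (A_neq0 : A != finset.set0) :
  exists f : T -> R, [/\ \sum_x f x ^+ 2 = 1, (forall x, x \notin A -> f x = 0) &
    forall g : T -> R, \sum_x g x ^+ 2 = 1 -> (forall x, x \notin A -> g x = 0) ->
      Q g <= Q f].
Proof.
pose X := prod_topology (fun _ : T => R : topologicalType).
have coordC (x : T) : continuous ((fun f : X => f x) : X -> R).
  exact: (@proj_continuous T (fun=> R) x).
pose nrm (f : X) : R := \sum_x f x ^+ 2.
have nrmC : continuous nrm.
  apply: (@continuous_big _ _ _ _ _ _ _ _ (fun x (f : X) => f x ^+ 2)) => [|x _ f].
    exact: add_continuous.
  exact: (continuous_comp (coordC x f) (@exprn_continuous R 2 (f x))).
pose S : set X := ((nrm @^-1` [set r | r = 1]) `&`
  \bigcap_(x in [set x | x \notin A]) ((fun f : X => f x) @^-1` [set r | r = 0]))%classic.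
have SE (f : T -> R) : S f <-> \sum_x f x ^+ 2 = 1 /\ forall x, x \notin A -> f x = 0.
  by split => -[f1 fA]; split.
have [||f /set_mem/SE[f1 fA] fmax] :=
  @compact_EVT_max X R Q S _ _ (continuous_subspaceT Qcont).
(* The constraint set is nonempty: it contains the point mass at any point of [A]. *)
- have [x xA] := finset.set0Pn _ A_neq0; exists (fun y => (y == x)%:R); apply/SE; split=> [|y].
    rewrite (bigD1 x) //= eqxx expr1n big1 ?addr0 // => y /negbTE ->.
    by rewrite expr0n.
  by case: eqP => [->|//]; rewrite xA.
(* The constraint set is closed in the cube of functions with values in [-1, 1], compact by
   Tychonoff; it lies there because each squared value is at most the total sum 1. *)
- apply: (@subclosed_compact X _ [set f : X | forall x, `[-1, 1]%classic (f x)]%classic).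
  + apply: closedI; first by apply: preimage_closed => [f _|]; [exact: nrmC|exact: closed_eq].
    by apply: closed_bigI => x _; apply: preimage_closed => [f _|];
      [exact: coordC|exact: closed_eq].
  + by apply: (@tychonoff T (fun=> R) (fun=> `[-1, 1]%classic)) => x; exact: segment_compact.
  + move=> f /SE[f1 _] x; rewrite /= in_itv /= -ler_norml -[`|f x|]ger0_norm //.
    rewrite -(@ler_pXn2r _ 2) ?nnegrE // expr1n -f1 normr_id real_normK ?num_real //.
    by rewrite (bigD1 x) //= lerDl sumr_ge0 // => y _; apply: sqr_ge0.
by exists f; split=> // g g1 gA; apply: fmax; apply/mem_set/SE.
Qed.

Lemma energy_continuous (R : realType) (V : finZmodType) :
  continuous (@energy R V : prod_topology (fun=> R) -> R).
Proof.
pose X := prod_topology (fun _ : V => R : topologicalType).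
have coordC (x : V) : continuous ((fun f : X => f x) : X -> R).
  exact: (@proj_continuous V (fun=> R) x).
have corrC s : continuous ((fun f : X => correlation f f s) : X -> R).
  apply: (@continuous_big _ _ _ _ _ _ _ _ (fun a (f : X) => f a * f (a + s))) => [|a _ f].
    exact: add_continuous.
  exact: (continuousM (coordC a f) (coordC (a + s) f)).
apply: (@continuous_big _ _ _ _ _ _ _ _
  (fun s (f : X) => correlation f f s ^+ 2)) => [|s _ f].
  exact: add_continuous.
exact: (continuous_comp (corrC s f) (@exprn_continuous R 2 _)).
Qed.

(** * Coordinate transpositions as transvections, and their action on the Hamming sphere *)

Section HammingSphere.
Variables (R : realType) (n k : nat).
Notation V := 'rV['F_2]_n.
Notation A := (hamming_sphere n k).

Lemma addF2 (a : 'F_2) : a + a = 0.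
Proof. by rewrite -mulr2n -mulr_natr (_ : 2%:R = 0 :> 'F_2) ?mulr0 //; exact: val_inj. Qed.

Lemma F2P (a : 'F_2) : {a = 0} + {a = 1}.
Proof. by case: a => [[|[|//]] ?]; [left|right]; exact: val_inj. Qed.

Lemma addVV (x : V) : x + x = 0.
Proof. by apply/rowP => i; rewrite !mxE addF2. Qed.

Definition differ (i j : 'I_n) (v : V) : bool := v ord0 i + v ord0 j == 1.

Definition flip (i j : 'I_n) : V := delta_mx ord0 i + delta_mx ord0 j.

Lemma differD i j x y : differ i j (x + y) = differ i j x (+) differ i j y.
Proof.
rewrite /differ !mxE addrACA.
by case: (F2P (x ord0 i + x ord0 j)) => ->; case: (F2P (y ord0 i + y ord0 j)) => ->.
Qed.

Lemma differ_flip i j : differ i j (flip i j) = false.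
Proof. by rewrite /differ /flip !mxE !eqxx /= addrC addrACA addF2 [j == i]eq_sym addF2. Qed.

(** Exchanging two equal bits does nothing; exchanging two different bits adds 1 to both. *)
Lemma transvection_swap i j v :
  transvection V (differ i j) (flip i j) v = col_perm (tperm i j) v.
Proof.
rewrite /transvection /differ; apply/rowP => m.
case: ifP => [/eqP vij|/eqP vij].
  have ij : i != j by apply: contra_eq_neq vij => ->; rewrite addF2.
  rewrite !mxE !eqxx /=; case: tpermP => [->|->|/eqP/negbTE-> /eqP/negbTE->].
  - rewrite eqxx (negbTE ij) addr0.
    by move: vij; case: (F2P (v ord0 i)) => ->; case: (F2P (v ord0 j)) => -> // _;
      exact: val_inj.
  - rewrite eqxx eq_sym (negbTE ij) add0r.
    by move: vij; case: (F2P (v ord0 i)) => ->; case: (F2P (v ord0 j)) => -> // _;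
      exact: val_inj.
  - by rewrite !addr0.
have vE : v ord0 i = v ord0 j.
  by move: vij; case: (F2P (v ord0 i)) => ->; case: (F2P (v ord0 j)) => ->;
    rewrite ?addr0 ?add0r.
by rewrite !mxE; case: tpermP => [->|->|].
Qed.

Lemma hamming_sphere_col_perm s v : (col_perm s v \in A) = (v \in A).
Proof.
rewrite !inE; congr (_ == _).
rewrite -[RHS](card_preimset _ (@perm_inj _ s)); apply: eq_card => i.
by rewrite !inE !mxE.
Qed.

Lemma hamming_sphere_transitive v w : v \in A -> w \in A ->
  exists s : {perm 'I_n}, w = col_perm s v.
Proof.
(* A vector of the sphere has [k] entries 1 and [n - k] entries 0, so the entry lists of [v] and [w]
   have the same counts and are permutations of each other. *)
have cnt u (a : pred 'F_2) : u \in A ->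
    count a [tuple u ord0 i | i < n] = (k * a 1%R + (n - k) * a 0%R)%N.
  rewrite inE => /eqP uk; pose S := [set i | u ord0 i == 1].
  have nk : (n - k)%N = #|~: S| by rewrite cardsCs finset.setCK card_ord -uk.
  rewrite nk -{}uk count_map -sum1_count big_enum_cond (bigID (mem S)) /=.
  rewrite -!sum_nat_const; congr addn; rewrite big_mkcond [RHS]big_mkcond;
    apply: eq_bigr => i _.
    by rewrite inE /=; case: eqP => [->|_]; rewrite ?andbT ?andbF; case: (a 1).
  by rewrite !inE /=; case: (F2P (u ord0 i)) => -> /=; rewrite ?andbT ?andbF.
move=> vA wA.
have /tuple_permP[s ws] : perm_eq [tuple w ord0 i | i < n] [tuple v ord0 i | i < n].
  by apply/seq.permP => a; rewrite !cnt.
exists s; apply/rowP => i; rewrite mxE.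
have := congr1 (fun t => nth 0 t i) ws.
by rewrite -!tnth_nth !tnth_mktuple.
Qed.

(** Every permutation is a product of transpositions. *)
Lemma col_perm_invariant (f : V -> R) :
  (forall i j v, f (col_perm (tperm i j) v) = f v) -> forall s v, f (col_perm s v) = f v.
Proof.
move=> finv s v; have [ts -> _] := prod_tpermP s.
elim: ts => [|t ts IH]; first by rewrite big_nil col_perm1.
by rewrite big_cons col_permM finv.
Qed.

Lemma hamming_sphere_neq0 : (k <= n)%N -> A != finset.set0.
Proof.
move=> kn; apply/finset.set0Pn; exists (\row_i (i < k)%N%:R).
have widen_inj : injective (widen_ord kn) by move=> i j [/val_inj].
rewrite inE -[X in _ == X](card_ord k) -(card_imset _ widen_inj).
apply/eqP/eq_card => i; rewrite !inE mxE.
apply/idP/imsetP => [|[j _ ->]] /=; last by rewrite ltn_ord.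
by case: ltnP => // ik _; exists (Ordinal ik) => //; apply: val_inj.
Qed.

Lemma eq_indicator (f : V -> R) :
  (forall x, x \notin A -> f x = 0) ->
  (forall i j v, f (col_perm (tperm i j) v) = f v) ->
  exists c, f =1 fun x => c * indicator R A x.
Proof.
move=> fA /col_perm_invariant finv.
have [A0|[v vA]] := set_0Vmem A.
  by exists 0 => x; rewrite mul0r fA // A0 inE.
exists (f v) => x; rewrite ffunE; case: (boolP (x \in A)) => [xA|/fA->]; last by rewrite mulr0.
by have [s ->] := hamming_sphere_transitive _ _ vA xA; rewrite finv mulr1.
Qed.

(** * The sharp energy bound on the Hamming sphere *)

Lemma energy_indicator : energy (indicator R A) = (additive_energy A)%:R.
Proof.
rewrite -energyE; last exact: addVV.
rewrite /additive_energy -sum1_card natr_sum big_mkcond [RHS]big_mkcond /=.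
apply: eq_bigr => -[[[a b] c] d] _; rewrite in_set !in_set /=.
case: (a + b == c + d) => //=; rewrite !ffunE.
rewrite !in_set -!natrM !mulnb -!andbA.
by case: ifP.
Qed.

Lemma sum_indicator_sqr : \sum_x indicator R A x ^+ 2 = #|A|%:R.
Proof.
rewrite -sum1_card natr_sum [RHS]big_mkcond; apply: eq_bigr => x _.
by rewrite ffunE; case: (x \in A); rewrite ?expr1n ?expr0n.
Qed.

Lemma energy_le (f : V -> R) : (k <= n)%N -> (forall x, x \notin A -> f x = 0) ->
  energy f <= (\sum_x f x ^+ 2) ^+ 2 * ((additive_energy A)%:R / #|A|%:R ^+ 2).
Proof.
move=> /hamming_sphere_neq0 A0 fA.
have cA : #|A|%:R != 0 :> R by rewrite pnatr_eq0 cards_eq0.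
have [F0 [F01 F0A F0max]] := sphere_maximizer R V A energy (energy_continuous R V) A0.
pose F x := `|F0 x|.
have F1 : \sum_x F x ^+ 2 = 1.
  by rewrite -F01; apply: eq_bigr => x _; rewrite real_normK ?num_real.
have FA x : x \notin A -> F x = 0 by move=> /F0A; rewrite /F => ->; rewrite normr0.
have Fmax g : \sum_x g x ^+ 2 = 1 -> (forall x, x \notin A -> g x = 0) -> energy g <= energy F.
  move=> g1 gA; apply: le_trans (F0max g g1 gA) _; exact: energy_le_abs.
(* Otherwise symmetrising would strictly increase the energy while keeping the norm and the support
   in the sphere, against the maximality of [F]. *)
have Finv i j v : F (col_perm (tperm i j) v) = F v.
  rewrite -transvection_swap; apply/eqP; apply: contraT => Fv.
  have := energy_symmetrize_lt R V addVV _ _ (differD i j) (differ_flip i j) F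
    (fun=> normr_ge0 _) v Fv.
  rewrite ltNge Fmax // => [|x xA].
    by rewrite sum_symmetrize_sqr //; [exact: addVV|exact: differD|exact: differ_flip].
  rewrite /symmetrize FA // transvection_swap FA ?hamming_sphere_col_perm //.
  by rewrite expr0n addr0 mul0r sqrtr0.
have [c Fc] := eq_indicator F FA Finv.
(* The norm condition on [F] reads [c ^+ 2 * #|A| = 1]. *)
have c2 : c ^+ 2 = #|A|%:R^-1.
  apply: (mulIf cA); rewrite mulVf // -sum_indicator_sqr mulr_sumr -[RHS]F1.
  by apply: eq_bigr => x _; rewrite Fc exprMn.
have energyF : energy F = (additive_energy A)%:R / #|A|%:R ^+ 2.
  rewrite (eq_energy _ _ _ _ Fc) energyZ energy_indicator.
  by rewrite -[4%N]/(2 * 2)%N exprM c2 exprVn mulrC.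
set s := \sum_x f x ^+ 2.
have s_ge0 : 0 <= s by apply: sumr_ge0 => x _; apply: sqr_ge0.
have [s0|s_neq0] := eqVneq s 0.
  have f0 : f =1 fun x => 0 * f x.
    by move=> x; rewrite mul0r; apply: sum_sqr_eq0.
  by rewrite (eq_energy _ _ _ _ f0) energyZ s0 !expr0n !mul0r.
(* Normalise [f] to the unit sphere; the energy is homogeneous of degree 4, which gives the factor
   [s ^+ 2]. *)
have := Fmax (fun x => (Num.sqrt s)^-1 * f x).
rewrite energyZ energyF exprVn -[4%N]/(2 * 2)%N exprM sqr_sqrtr //.
rewrite ler_pdivrMl ?exprn_gt0 ?lt0r ?s_neq0 //; apply=> [|x xA]; last by rewrite fA ?mulr0.
under eq_bigr do rewrite exprMn exprVn sqr_sqrtr //.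
by rewrite -mulr_sumr mulVf.
Qed.

(** * Normalisation: from the energy to [u2_ratio] *)

Lemma card_additive_quads : #|additive_quads n|%:R = (2 ^ n)%N%:R ^+ 3 :> R.
Proof.
rewrite -sum1_card natr_sum.
(* The energy of the constant 1 counts the quadruples; each of its N correlations equals N. *)
transitivity (energy (fun _ : V => 1 : R)).
  rewrite -energyE; last exact: addVV.
  by apply: eq_big => -[[[a b] c] d]; rewrite ?inE ?mulr1.
rewrite /energy.
have cV : #|V| = (2 ^ n)%N by rewrite card_mx card_Fp // mul1n.
rewrite (eq_bigr (fun=> (2 ^ n)%N%:R ^+ 2)) => [|s _].
  by rewrite sumr_const cV -[LHS]mulr_natl -exprS.
by rewrite /correlation mulr1 sumr_const cV.
Qed.

Lemma u2_ratioE (f : {ffun V -> R}) :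
  u2_ratio f = 1 / (2 ^ n)%N%:R * (energy f / (\sum_x f x ^+ 2) ^+ 2).
Proof.
have N0 : (2 ^ n)%N%:R != 0 :> R by rewrite pnatr_eq0 expn_eq0.
set s := \sum_x _.
have s_ge0 : 0 <= s by apply: sumr_ge0 => x _; apply: sqr_ge0.
rewrite /u2_ratio.
have -> : u2norm f ^+ 4 = energy f / (2 ^ n)%N%:R ^+ 3.
  rewrite /u2norm /expect card_additive_quads.
  have -> : \sum_(x in additive_quads n) (let '(a1, a2, a3, a4) := x in
      f a1 * f a2 * f a3 * f a4) = energy f.
    by rewrite -energyE; [apply: eq_bigl => -[[[a b] c] d]; rewrite inE|exact: addVV].
  rewrite -powR_mulrn ?powR_ge0 // -powRrM mulVf ?pnatr_eq0 // powRr1 //.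
  by rewrite divr_ge0 ?energy_ge0 ?exprn_ge0.
have -> : l2norm f ^+ 4 = (s / (2 ^ n)%N%:R) ^+ 2.
  rewrite /l2norm /expect cardsT card_mx card_Fp // mul1n -[4%N]/(2 * 2)%N exprM.
  rewrite sqr_sqrtr; first by rewrite (eq_bigl xpredT) // => x; rewrite inE.
  by rewrite divr_ge0 // sumr_ge0 // => x _; apply: sqr_ge0.
(* For the zero function both sides are 0, by the convention that the inverse of 0 is 0. *)
have [->|s0] := eqVneq s 0; first by rewrite mul0r !expr0n !invr0 !mulr0.
by field; rewrite s0.
Qed.

Lemma admissible_sum_sqr_gt0 (f : {ffun V -> R}) : admissible A f -> 0 < \sum_x f x ^+ 2.
Proof.
case=> f0 _; rewrite lt0r sumr_ge0 ?andbT => [|x _]; last exact: sqr_ge0.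
by apply: contra_neq f0 => s0; apply/ffunP => x; rewrite ffunE; apply: sum_sqr_eq0.
Qed.

Lemma u2_ratio_le (f : {ffun V -> R}) : (k <= n)%N -> admissible A f ->
  u2_ratio f <= 1 / (2 ^ n)%N%:R * ((additive_energy A)%:R / #|A|%:R ^+ 2).
Proof.
move=> kn fadm; rewrite u2_ratioE ler_wpM2l ?divr_ge0 //.
rewrite ler_pdivrMr ?exprn_gt0 ?admissible_sum_sqr_gt0 // mulrC energy_le // => x xA.
by apply/eqP; apply: contraNT xA; case: fadm => _ /subsetP; apply.
Qed.

Lemma u2_ratio_indicator (c : R) : c != 0 ->
  u2_ratio [ffun x => c * indicator R A x] =
    1 / (2 ^ n)%N%:R * ((additive_energy A)%:R / #|A|%:R ^+ 2).
Proof.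
move=> c0; rewrite u2_ratioE.
have cE : [ffun x => c * indicator R A x] =1 fun x => c * indicator R A x.
  by move=> x; rewrite ffunE.
rewrite (eq_energy _ _ _ _ cE) energyZ energy_indicator.
under eq_bigr do rewrite cE exprMn.
rewrite -mulr_sumr sum_indicator_sqr exprMn -exprM; congr (_ * _).
by rewrite -mulf_div divff ?mul1r // expf_neq0.
Qed.

Lemma admissible_indicator (c : R) : (k <= n)%N -> c != 0 ->
  admissible A [ffun x => c * indicator R A x].
Proof.
move=> /hamming_sphere_neq0/finset.set0Pn[v vA] c0; split.
  by apply/eqP => /ffunP/(_ v); rewrite !ffunE vA mulr1; apply/eqP.
by apply/subsetP => x; rewrite inE !ffunE; apply: contraR => /negbTE->; rewrite mulr0.
Qed.

End HammingSphere.

Theorem theorem1p1 (R : realType) (n k : nat) (hn : (1 <= n)%N) (hk : (k <= n)%N) :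
  mu R (hamming_sphere n k) =
    1 / (2 ^ n)%N%:R *
    ((additive_energy (hamming_sphere n k))%:R / #|hamming_sphere n k|%:R ^+ 2)
  /\
  forall c : R, c != 0 ->
    is_maximizer (hamming_sphere n k) [ffun x => c * indicator R (hamming_sphere n k) x].
Proof.
split=> [|c c0]; last first.
  split=> [|f fadm]; first exact: admissible_indicator.
  by rewrite u2_ratio_indicator // u2_ratio_le.
set M := 1 / _ * _; rewrite /mu; set S := (X in sup X).
(* [M] is both attained, with [c = 1], and an upper bound, hence equal to the supremum. *)
have SM : S M.
  exists [ffun x => 1 * indicator R (hamming_sphere n k) x]; last first.
    by rewrite u2_ratio_indicator ?oner_neq0.
  exact: admissible_indicator (oner_neq0 _).
have ubM : ubound S M by move=> _ [f fadm <-]; exact: u2_ratio_le.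
apply/eqP; rewrite eq_le ge_sup //=; last by exists M.
by apply: ub_le_sup => //; exists M.
Qed.
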